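(* Let $G$ be a Lie group with a bi-invariant Riemannian metric $\kappa$, let $L\colon TG\to\mathbb{R}$, $L(v_g)=\tfrac12\kappa(v_g,v_g)$, be the associated (regular, bi-invariant) Lagrangian, and let $\mathcal{D}\subset TG$ be an arbitrary smooth distribution of constant rank (no invariance of $\mathcal{D}$ is assumed). Let $\mathcal{P}\colon TG\to\mathcal{D}$ and $\mathcal{Q}\colon TG\to\mathcal{D}^\perp$ be the complementary orthogonal projectors with respect to $\kappa$. Let $L_d\colon G\times G\to\mathbb{R}$ be a smooth discrete Lagrangian that is left-invariant, i.e. $L_d(hg_0,hg_1)=L_d(g_0,g_1)$ for all $h,g_0,g_1\in G$. Then the discrete nonholonomic method $$\mathcal{P}^*_{g_k}\big(D_1L_d(g_k,g_{k+1})\big)+\mathcal{P}^*_{g_k}\big(D_2L_d(g_{k-1},g_k)\big)=0,$$ $$\mathcal{Q}^*_{g_k}\big(D_1L_d(g_k,g_{k+1})\big)-\mathcal{Q}^*_{g_k}\big(D_2L_d(g_{k-1},g_k)\big)=0$$ is energy-preserving: if $g_0,g_1,\dots,g_N\in G$ (with $N\ge 2$) satisfies these two equations for every $1\le k\le N-1$, then, with $p^-_{k,k+1}=-D_1L_d(g_k,g_{k+1})\in T^*_{g_k}G$, $$H(g_k,p^-_{k,k+1})=H(g_{k-1},p^-_{k-1,k})\qquad\text{for all }1\le k\le N-1,$$ where $H\colon T^*G\to\mathbb{R}$ is the energy function of $L$.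
   Context: $D_1L_d(g_0,g_1)\in T^*_{g_0}G$ and $D_2L_d(g_0,g_1)\in T^*_{g_1}G$ denote the partial differentials of $L_d$ with respect to its first and second argument. $\mathcal{D}^\perp$ is the $\kappa$-orthogonal complement of $\mathcal{D}$. For $g\in G$, $\mathcal{P}_g$ and $\mathcal{Q}_g$ are the orthogonal projections of $T_gG$ onto $\mathcal{D}_g$ and $\mathcal{D}_g^\perp$, regarded as endomorphisms of $T_gG$, and $\mathcal{P}_g^*,\mathcal{Q}_g^*\colon T^*_gG\to T^*_gG$ are their dual maps, $(\mathcal{P}_g^*p)(v)=p(\mathcal{P}_gv)$ and likewise for $\mathcal{Q}$. A metric on $G$ is bi-invariant if it is invariant under both left and right translations. The energy function is $H=\langle \partial L/\partial\dot g,\dot g\rangle-L$, expressed as a function of the position $g$ and the momentum $p=\partial L/\partial\dot g$; explicitly $H(g,p)=\tfrac12\langle p,p^\sharp\rangle$ for $p\in T_g^*G$, where $p^\sharp\in T_gG$ is defined by $\kappa(p^\sharp,v)=p(v)$ for all $v\in T_gG$. *)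

(* Defs.v *)
From HB Require Import structures.
From mathcomp Require Import all_boot all_order all_algebra.
From mathcomp Require Import all_classical all_reals all_analysis.
From mathcomp Require Import ring.

Set Implicit Arguments.
Unset Strict Implicit.
Unset Printing Implicit Defensive.

Import Order.TTheory GRing.Theory Num.Theory.
Import numFieldNormedType.Exports.

Local Open Scope classical_set_scope.
Local Open Scope ring_scope.

Section Smooth.
Context {R : realType}.

(* For finite-dimensional V and open U, this is class C^k on U: the
   derivatives of order at most k exist as Frechet differentials and are
   continuous. *)
Fixpoint Ck_on (V W : normedModType R) (k : nat) (U : set V) (f : V -> W)
    : Prop :=
  match k with
  | 0%N => forall x, U x -> {for x, continuous f}
  | k'.+1 => (forall x, U x -> differentiable f x) /\
             (forall v : V, Ck_on k' U (fun x => 'd f x v))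
  end.

Definition smooth_on (V W : normedModType R) (U : set V) (f : V -> W) : Prop :=
  forall k, Ck_on k U f.

(* The values of cmap outside dom, and of cinv outside cmap @` dom, are
   irrelevant. *)
Record chart (M : Type) (E : normedModType R) := Chart {
  dom : set M;
  cmap : M -> E;
  cinv : E -> M
}.

Definition is_chart (M : topologicalType) (E : normedModType R)
    (c : chart M E) : Prop :=
  [/\ open (dom c), open (cmap c @` dom c),
      forall x, dom c x -> cinv c (cmap c x) = x,
      {within dom c, continuous (cmap c)} &
      {within cmap c @` dom c, continuous (cinv c)}].

Definition smooth_compatible (M : Type) (E : normedModType R)
    (c c' : chart M E) : Prop :=
  smooth_on (cmap c @` (dom c `&` dom c')) (cmap c' \o cinv c).

Definition prod_chart (M N : Type) (E F : normedModType R)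
    (c : chart M E) (d : chart N F) : chart (M * N) (E * F)%type :=
  Chart (dom c `*` dom d)
        (fun p => (cmap c p.1, cmap d p.2))
        (fun q => (cinv c q.1, cinv d q.2)).

Definition prod_atlas (M N : Type) (E F : normedModType R)
    (A : set (chart M E)) (B : set (chart N F))
    : set (chart (M * N) (E * F)%type) :=
  [set e | exists c d, [/\ A c, B d & e = prod_chart c d]].

Definition flat_atlas (E : normedModType R) : set (chart E E) :=
  [set Chart setT idfun idfun].

Definition smooth_map (M N : topologicalType) (E F : normedModType R)
    (A : set (chart M E)) (B : set (chart N F)) (f : M -> N) : Prop :=
  continuous f /\
  forall c d, A c -> B d ->
    smooth_on (cmap c @` (dom c `&` f @^-1` dom d)) (cmap d \o f \o cinv c).

End Smooth.

Arguments flat_atlas {R} E.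

(* The atlas need not be maximal. The chart chart_at x selected around x serves
   only to give coordinates on the tangent space at x. *)
HB.mixin Record isManifold (R : realType) (n : nat) M of Topological M := {
  atlas : set (chart (R := R) M 'rV[R]_n);
  chart_at : M -> chart (R := R) M 'rV[R]_n;
  manifold_hausdorff : hausdorff_space M;
  manifold_second_countable : @second_countable M;
  atlas_chart : forall c, atlas c -> is_chart c;
  atlas_compatible : forall c c', atlas c -> atlas c' -> smooth_compatible c c';
  chart_at_atlas : forall x, atlas (chart_at x);
  chart_at_dom : forall x, dom (chart_at x) x
}.

#[short(type="manifoldType")]
HB.structure Definition Manifold (R : realType) (n : nat) :=
  {M of Topological M & isManifold R n M}.

Arguments atlas {R n} M : rename.
Arguments chart_at {R n M} x : rename.

HB.mixin Record isLieGroup (R : realType) (n : nat) G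
    of Group G & Manifold R n G := {
  smooth_mulg : smooth_map (prod_atlas (atlas G) (atlas G)) (atlas G)
                  (fun p : G * G => (p.1 * p.2)%g);
  smooth_invg : smooth_map (atlas G) (atlas G) (fun x : G => (x^-1)%g)
}.

#[short(type="lieGroupType")]
HB.structure Definition LieGroup (R : realType) (n : nat) :=
  {G of Group G & Manifold R n G & isLieGroup R n G}.

Section Tangent.
Context {R : realType} {n : nat} {M : manifoldType R n}.

(* A tangent vector at x is represented by its coordinates in the chart
   chart_at x. *)
Definition tangent (x : M) : vectType R := 'rV[R]_n.

Definition cotangent (x : M) : vectType R := 'Hom(tangent x, R^o).

(* c' is the chart in which v is expressed, c the chart to which v is moved. *)
Definition change_coord (c' c : chart M 'rV[R]_n) (x : M) (v : 'rV[R]_n)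
    : 'rV[R]_n :=
  'd (cmap c \o cinv c') (cmap c' x) v.

Definition coord (c : chart M 'rV[R]_n) (x : M) (v : tangent x) : 'rV[R]_n :=
  change_coord (chart_at x) c x v.

Definition vec (c : chart M 'rV[R]_n) (x : M) (a : 'rV[R]_n) : tangent x :=
  change_coord c (chart_at x) x a.

Definition differential (f : M -> R) (x : M) : cotangent x :=
  linfun ('d (f \o cinv (chart_at x) : 'rV[R]_n -> R^o) (cmap (chart_at x) x)).

Definition dual_map (x : M) (P : 'End(tangent x)) (p : cotangent x)
    : cotangent x := (p \o P)%VF.

Definition smooth_vector_field_on (U : set M) (X : forall x : M, tangent x)
    : Prop :=
  forall c, atlas M c ->
    smooth_on (cmap c @` (dom c `&` U))
      (fun y => coord c (X (cinv c y))).

Definition smooth_distribution (r : nat) (D : forall x : M, {vspace tangent x})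
    : Prop :=
  forall x0 : M, exists U : set M, exists X : 'I_r -> forall x : M, tangent x,
    [/\ open U, U x0,
        forall i, smooth_vector_field_on U (X i) &
        forall x, U x ->
          \dim (D x) = r /\ D x = <<[seq X i x | i <- enum 'I_r]>>%VS].

Record riemannian_metric (kappa : forall x : M, tangent x -> tangent x -> R)
    : Prop := {
  metric_linearl : forall x (a : R) (u v w : tangent x),
    kappa x (a *: u + v) w = a * kappa x u w + kappa x v w;
  metric_sym : forall x u v, kappa x u v = kappa x v u;
  metric_pos : forall x v, v != 0 -> 0 < kappa x v v;
  metric_smooth : forall c, atlas M c -> forall a b : 'rV[R]_n,
    smooth_on (cmap c @` dom c)
      (fun y => let x := cinv c y in kappa x (vec c x a) (vec c x b) : R^o)
}.

Section Metric.
Variable kappa : forall x : M, tangent x -> tangent x -> R.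

Definition orthogonal_complement (x : M) (A : set (tangent x))
    : set (tangent x) :=
  [set v | forall w, A w -> kappa v w = 0].

Definition orthogonal_projector (x : M) (A : set (tangent x))
    (P : 'End(tangent x)) : Prop :=
  forall v, A (P v) /\ orthogonal_complement A (v - P v).

Definition kinetic_lagrangian (x : M) (v : tangent x) : R :=
  2^-1 * kappa v v.

Definition is_sharp (x : M) (p : cotangent x) (u : tangent x) : Prop :=
  forall v, kappa u v = p v.

End Metric.

Section Lagrangian.
Variable L : forall x : M, tangent x -> R.

(* The fibre derivative of L. *)
Definition dL_dv (x : M) (v w : tangent x) : R :=
  'D_(w : 'rV[R]_n) (@L x : 'rV[R]_n -> R^o) v.

Definition energy (x : M) (v : tangent x) : R := dL_dv v v - L v.

(* The energy as a function of position and momentum, through the inverse of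
   the Legendre transformation v |-> dL_dv v. *)
Definition hamiltonian (x : M) (p : cotangent x) : R :=
  energy (xget 0 [set v : tangent x | forall w, dL_dv v w = p w]).

End Lagrangian.

Lemma dL_dv_kinetic kappa (x : M) (v w : tangent x) :
  riemannian_metric kappa ->
  dL_dv (kinetic_lagrangian kappa) v w = kappa x v w.
Proof.
move=> km.
have kD u1 u2 u3 : kappa x (u1 + u2) u3 = kappa x u1 u3 + kappa x u2 u3.
  by rewrite -[in LHS](scale1r u1) (metric_linearl km) mul1r.
have k0 u : kappa x 0 u = 0.
  by apply: (@addrI _ (kappa x 0 u)); rewrite -kD !addr0.
have kZ a u1 u2 : kappa x (a *: u1) u2 = a * kappa x u1 u2.
  by rewrite -[in LHS](addr0 (a *: u1)) (metric_linearl km) k0 addr0.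
rewrite /dL_dv /derive; apply: cvg_lim; first exact: norm_hausdorff.
have cv : (fun h : R => kappa x v w + h * (2^-1 * kappa x w w)) @ 0^'
    --> kappa x v w + 0 * (2^-1 * kappa x w w).
  apply: cvgD; first exact: cvg_cst.
  by apply: cvgM; [exact: nbhs_dnbhs | exact: cvg_cst].
rewrite mul0r addr0 in cv; apply: cvg_trans cv.
apply: near_eq_cvg; near=> h.
have h0 : h != 0 by near: h; exact: nbhs_dnbhs_neq.
rewrite /kinetic_lagrangian /= /GRing.scale /=.
rewrite kD !(metric_sym km _ (_ + _)) !kD !kZ !(metric_sym km _ (h *: w)) !kZ.
rewrite (metric_sym km w v).
by field.
Unshelve. all: by end_near. Qed.

Lemma hamiltonian_kinetic kappa (x : M) (p : cotangent x) :
  riemannian_metric kappa ->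
  hamiltonian (kinetic_lagrangian kappa) p =
  2^-1 * p (xget 0 [set u | is_sharp kappa p u]).
Proof.
move=> km; rewrite /hamiltonian.
have -> : [set v : tangent x | forall w,
    dL_dv (kinetic_lagrangian kappa) v w = p w] =
    [set u | is_sharp kappa p u].
  apply/seteqP; split=> v /= vp w; have := vp w.
    by rewrite dL_dv_kinetic.
  by rewrite dL_dv_kinetic.
rewrite /energy dL_dv_kinetic// /kinetic_lagrangian.
case: xgetP => [v _ /= vp | _].
  by rewrite -(vp v); field.
have k0 : kappa x 0 0 = 0.
  have := metric_linearl km (1 : R) 0 0 (0 : tangent x).
  rewrite scale1r addr0 mul1r => k00.
  by apply: (@addrI _ (kappa x 0 0)); rewrite addr0 -k00.
by rewrite k0 linear0 !mulr0 subr0.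
Qed.

End Tangent.

Section DiscreteLagrangian.
Context {R : realType} {n : nat} {M : manifoldType R n}.
Variable Ld : M -> M -> R.

Definition D1 (x y : M) : cotangent x := differential (Ld ^~ y) x.

Definition D2 (x y : M) : cotangent y := differential (Ld x) y.

Definition smooth_discrete_lagrangian : Prop :=
  smooth_map (prod_atlas (atlas M) (atlas M)) (flat_atlas R^o)
    (fun q : M * M => Ld q.1 q.2 : R^o).

End DiscreteLagrangian.

Section Group.
Context {R : realType} {n : nat} {G : lieGroupType R n}.

Definition tangent_map (f : G -> G) (x : G) (v : tangent x) : tangent (f x) :=
  'd (cmap (chart_at (f x)) \o f \o cinv (chart_at x)) (cmap (chart_at x) x) v.

Definition bi_invariant (kappa : forall x : G, tangent x -> tangent x -> R)
    : Prop :=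
  forall (h x : G) (u v : tangent x),
    kappa _ (tangent_map (fun y => (h * y)%g) u)
            (tangent_map (fun y => (h * y)%g) v) = kappa x u v /\
    kappa _ (tangent_map (fun y => (y * h)%g) u)
            (tangent_map (fun y => (y * h)%g) v) = kappa x u v.

Definition left_invariant (Ld : G -> G -> R) : Prop :=
  forall h x y : G, Ld (h * x)%g (h * y)%g = Ld x y.

End Group.

(* Main.v *)
(* Left invariance makes L_d constant along h |-> (h x, h y).  With y' = h y
   this says that L_d (y' (y^-1 x), y') does not depend on y', so the chain rule
   gives D1 L_d (x, y) o T = - D2 L_d (x, y), where T is the tangent map at y of
   the right translation by y^-1 x.  By right invariance of the metric T is an
   isometry, hence - D1 L_d (x, y) and - D2 L_d (x, y) have the same energy.
   The two equations of the method say that D1 L_d (g_k, g_(k+1)) is obtained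
   from D2 L_d (g_(k-1), g_k) by the orthogonal reflection Q - P, which is also
   an isometry. *)

Require Import Defs.
From mathcomp Require Import all_boot all_order all_algebra.
From mathcomp Require Import all_classical all_reals all_analysis.
From mathcomp Require Import ring.

Import Order.TTheory GRing.Theory Num.Theory.
Import numFieldNormedType.Exports.

Local Open Scope classical_set_scope.
Local Open Scope ring_scope.

Set Implicit Arguments.
Unset Strict Implicit.
Unset Printing Implicit Defensive.

(** * Differential calculus on normed spaces *)

Section Differentials.
Context {R : realType}.

Lemma diff_locally_cst (V W : normedModType R) (f : V -> W) (a v : V) (c : W) :
  differentiable f a -> (\forall x \near a, f x = c) -> 'd f a v = 0.
Proof.
move=> df fc; rewrite -deriveE// (near_eq_derive (g := cst c))//.
exact: derive_cst.
Qed.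

(** Chain rule along the affine insertion [u |-> (u, b)]; it turns a partial differential into a
    restriction of the full one. *)
Lemma is_diff_cst_pair (V W Z : normedModType R) (F : V * W -> Z) a b :
  differentiable F (a, b) ->
  is_diff a (fun u => F (u, b)) (fun u => 'd F (a, b) (u, 0)).
Proof.
move=> dF; have dp : is_diff a (fun u => (u, b)) (fun u => (u, 0)).
  exact: (is_diff_pair (f := id) (g := cst b)).
exact: (is_diff_comp (g := F) (f := fun u => (u, b)) dp (differentiableP dF)).
Qed.

Lemma is_diff_pair_cst (V W Z : normedModType R) (F : V * W -> Z) a b :
  differentiable F (a, b) ->
  is_diff b (fun w => F (a, w)) (fun w => 'd F (a, b) (0, w)).
Proof.
move=> dF; have dp : is_diff b (fun w => (a, w)) (fun w => (0, w)).
  exact: (is_diff_pair (f := cst a) (g := id)).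
exact: (is_diff_comp (g := F) (f := fun w => (a, w)) dp (differentiableP dF)).
Qed.

Lemma smooth_map_differentiable (M N : topologicalType) (E F : normedModType R)
    (A : set (chart M E)) (B : set (chart N F)) (f : M -> N) c d x :
  smooth_map A B f -> A c -> B d -> dom c x -> dom d (f x) ->
  differentiable (cmap d \o f \o cinv c) (cmap c x).
Proof.
by move=> [_ sf] Ac Bd cx dfx; have [+ _] := sf _ _ Ac Bd 1%N; apply; exists x.
Qed.

End Differentials.

(** [p] is [- q] on the image of [P] and [q] on that of [Q], so
    [p (Q v - P v) = q (Q v) + q (P v) = q v]. *)
Lemma lfun_reflection (K : fieldType) (V W : vectType K) (p q : 'Hom(V, W))
    (P Q : 'End(V)) :
  (p \o P)%VF + (q \o P)%VF = 0 -> (p \o Q)%VF - (q \o Q)%VF = 0 ->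
  (forall v, Q v = v - P v) -> forall v, p ((Q - P) v) = q v.
Proof.
move=> /eqP; rewrite addr_eq0 => /eqP eP /eqP; rewrite subr_eq0 => /eqP eQ QE v.
rewrite add_lfunE opp_lfunE linearB /=.
rewrite -[p (Q v)]comp_lfunE -[p (P v)]comp_lfunE.
by rewrite eP eQ opp_lfunE !comp_lfunE opprK -linearD /= QE subrK.
Qed.

(** * Coordinates in the selected charts *)

Section ChartAt.
Context {R : realType} {n : nat} {M : manifoldType R n}.

Lemma chart_atK (x : M) : cinv (chart_at x) (cmap (chart_at x) x) = x.
Proof.
have [_ _ + _ _] := atlas_chart _ (chart_at_atlas x).
by apply; exact: chart_at_dom.
Qed.

(** The image of a chart is open, so continuity within it is plain continuity at its points. *)
Lemma cinv_chart_at_cvg (x : M) :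
  cinv (chart_at x) @ cmap (chart_at x) x --> x.
Proof.
have [_ oi _ _] := atlas_chart _ (chart_at_atlas x).
rewrite continuous_open_subspace// => /(_ (cmap (chart_at x) x)).
rewrite /prop_for /continuous_at chart_atK; apply.
by rewrite inE; exists x => //; exact: chart_at_dom.
Qed.

Lemma differentialE (f : M -> R) (x : M) (v : tangent x) :
  differential f x v =
  'd (f \o cinv (chart_at x) : 'rV[R]_n -> R^o) (cmap (chart_at x) x) v.
Proof. by rewrite /differential lfunE. Qed.

End ChartAt.

(** * Partial differentials of the discrete Lagrangian *)

Section DiscreteDifferentials.
Context {R : realType} {n : nat} {M : manifoldType R n}.
Variable Ld : M -> M -> R.

(** Both arguments are kept in coordinates, so that [D1] and [D2] come from a single
    differential. *)
Definition coord_Ld (x y : M) (q : 'rV[R]_n * 'rV[R]_n) : R^o :=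
  Ld (cinv (chart_at x) q.1) (cinv (chart_at y) q.2).

Hypothesis Ld_smooth : smooth_discrete_lagrangian Ld.

Lemma coord_Ld_differentiable (x y : M) :
  differentiable (coord_Ld x y) (cmap (chart_at x) x, cmap (chart_at y) y).
Proof.
apply: (smooth_map_differentiable (x := (x, y))
  (c := prod_chart (chart_at x) (chart_at y)) (d := Chart setT idfun idfun)
  Ld_smooth) => //.
- by exists (chart_at x), (chart_at y); split => //; exact: chart_at_atlas.
- by split; exact: chart_at_dom.
Qed.

Lemma D1E (x y : M) (v : tangent x) : D1 Ld x y v =
  'd (coord_Ld x y) (cmap (chart_at x) x, cmap (chart_at y) y) (v, 0).
Proof.
have [_ E] := is_diff_cst_pair (coord_Ld_differentiable x y).
rewrite /D1 differentialE -(congr1 (@^~ v) E).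
by congr ('d _ _ _); apply/funext => u; rewrite /coord_Ld /= chart_atK.
Qed.

Lemma D2E (x y : M) (v : tangent y) : D2 Ld x y v =
  'd (coord_Ld x y) (cmap (chart_at x) x, cmap (chart_at y) y) (0, v).
Proof.
have [_ E] := is_diff_pair_cst (coord_Ld_differentiable x y).
rewrite /D2 differentialE -(congr1 (@^~ v) E).
by congr ('d _ _ _); apply/funext => u; rewrite /coord_Ld /= chart_atK.
Qed.

End DiscreteDifferentials.

(** * Isometries of tangent spaces preserve the energy *)

Section InvariantHamiltonian.
Context {R : realType} {n : nat} {M : manifoldType R n}.
Variable kappa : forall x : M, tangent x -> tangent x -> R.
Hypothesis km : riemannian_metric kappa.

Lemma metricDl (x : M) (u v w : tangent x) :
  kappa (u + v) w = kappa u w + kappa v w.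
Proof. by rewrite -[in LHS](scale1r u) (metric_linearl km) mul1r. Qed.

Lemma metric0l (x : M) (w : tangent x) : kappa 0 w = 0.
Proof. by apply: (@addrI _ (kappa 0 w)); rewrite -metricDl !addr0. Qed.

Lemma metricBl (x : M) (u v w : tangent x) :
  kappa (u - v) w = kappa u w - kappa v w.
Proof.
by rewrite addrC -scaleN1r (metric_linearl km) mulN1r addrC.
Qed.

Lemma metricBr (x : M) (u v w : tangent x) :
  kappa w (u - v) = kappa w u - kappa w v.
Proof. by rewrite (Defs.metric_sym km) metricBl !(Defs.metric_sym km _ w). Qed.

Lemma metricNN (x : M) (u v : tangent x) : kappa (- u) (- v) = kappa u v.
Proof.
have N w z : kappa (- w) z = - kappa w z.
  by rewrite -[- w]sub0r metricBl metric0l sub0r.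
by rewrite N (Defs.metric_sym km) N opprK (Defs.metric_sym km).
Qed.

Lemma metric_eq0 (x : M) (v : tangent x) : kappa v v = 0 -> v = 0.
Proof.
move=> v0; apply/eqP; case: eqVneq => // /(metric_pos km).
by rewrite v0 ltxx.
Qed.

Lemma is_sharp_inj (x : M) (p : cotangent x) (u v : tangent x) :
  is_sharp kappa p u -> is_sharp kappa p v -> u = v.
Proof.
move=> pu pv; apply/eqP; rewrite -subr_eq0; apply/eqP/metric_eq0.
by rewrite metricBl pu pv subrr.
Qed.

Lemma isometry_lker0 (x y : M) (T : 'Hom(tangent x, tangent y)) :
  (forall u v, kappa (T u) (T v) = kappa u v) -> lker T == 0%VS.
Proof.
move=> Tk; apply/lker0P => u v Tuv.
apply/eqP; rewrite -subr_eq0; apply/eqP/metric_eq0.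
by rewrite -Tk linearB /= Tuv subrr metric0l.
Qed.

(* The two tangent spaces have the same type of coordinates, so T can be used as
   an endomorphism, for which injective means surjective. *)
Lemma hamiltonian_isometry (x y : M) (T : 'Hom(tangent x, tangent y))
    (p : cotangent x) (q : cotangent y) :
  (forall u v, kappa (T u) (T v) = kappa u v) ->
  (forall v, q (T v) = p v) ->
  hamiltonian (kinetic_lagrangian kappa) q =
  hamiltonian (kinetic_lagrangian kappa) p.
Proof.
move=> Tk qT; have T0 := isometry_lker0 Tk.
have TK (w : tangent y) : T (T^-1%VF w) = w.
  exact: (@lker0_lfunVK _ (tangent x) T T0 w).
have sharpT u : is_sharp kappa p u -> is_sharp kappa q (T u).
  by move=> pu v; rewrite -(TK v) Tk pu qT.
have sharpV w : is_sharp kappa q w -> is_sharp kappa p (T^-1%VF w).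
  by move=> qw v; rewrite -Tk TK qw qT.
rewrite !hamiltonian_kinetic//.
(* [sharpT] and [sharpV] exclude the mixed cases; if neither sharp vector exists, both choices are
   the default 0. *)
case: xgetP => [w _ qw|qN]; case: xgetP => [u _ pu|pN].
- by rewrite (is_sharp_inj qw (sharpT _ pu)) qT.
- by case: (pN _ (sharpV _ qw)).
- by case: (qN _ (sharpT _ pu)).
- by rewrite !linear0.
Qed.

Section Reflection.
Variables (x : M) (D : set (tangent x)) (P Q : 'End(tangent x)).
Hypothesis P_proj : orthogonal_projector kappa D P.
Hypothesis Q_proj :
  orthogonal_projector kappa (orthogonal_complement kappa D) Q.

Lemma orthogonal_projectorC (v : tangent x) : Q v = v - P v.
Proof.
have [DP oP] := P_proj v; have [DQ oQ] := Q_proj v.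
apply/eqP; rewrite -subr_eq0; apply/eqP/metric_eq0.
(* w lies both in the complement of D and in the double complement. *)
set w := Q v - (v - P v).
have oD : orthogonal_complement kappa D w.
  by move=> z Dz; rewrite metricBl DQ // oP // subrr.
have {1}-> : w = P v - (v - Q v).
  by rewrite /w !opprB addrCA addrA.
by rewrite metricBl oQ // (Defs.metric_sym km) oD // subrr.
Qed.

(** [Q - P] is [id - 2 P], and orthogonality gives [kappa u (P v) = kappa (P u) (P v) = kappa (P u)
    v], so all terms in [P] cancel. *)
Lemma reflection_isometry (u v : tangent x) :
  kappa ((Q - P) u) ((Q - P) v) = kappa u v.
Proof.
have [DPu oPu] := P_proj u; have [DPv oPv] := P_proj v.
have e1 := oPu _ DPv; have e2 := oPv _ DPu.
rewrite metricBl in e1; rewrite metricBl (Defs.metric_sym km) in e2.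
rewrite !(add_lfunE, opp_lfunE) !orthogonal_projectorC !(metricBl, metricBr).
rewrite (Defs.metric_sym km (P v) (P u)) in e2.
by rewrite -(subr0_eq e1) in e2 *; rewrite (subr0_eq e2); ring.
Qed.

End Reflection.
End InvariantHamiltonian.

(** * Right translations and left invariance of the discrete Lagrangian *)

Section RightTranslation.
Context {R : realType} {n : nat} {G : lieGroupType R n}.

(** Multiplication is differentiable in product charts; its second coordinate is frozen at that of
    [h]. *)
Lemma right_translation_differentiable (h y : G) :
  differentiable
    (cmap (chart_at (y * h)%g) \o (fun z => (z * h)%g) \o cinv (chart_at y))
    (cmap (chart_at y) y).
Proof.
pose c := prod_chart (chart_at y) (chart_at h).
have dm : differentiable
    (cmap (chart_at (y * h)%g) \o (fun p : G * G => (p.1 * p.2)%g) \o cinv c)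
    (cmap (chart_at y) y, cmap (chart_at h) h).
  apply: (smooth_map_differentiable (x := (y, h)) smooth_mulg).
  - by exists (chart_at y), (chart_at h); split => //; exact: chart_at_atlas.
  - exact: chart_at_atlas.
  - by split; exact: chart_at_dom.
  - exact: chart_at_dom.
have [+ _] := is_diff_cst_pair dm.
by rewrite /comp /= chart_atK.
Qed.

Variable Ld : G -> G -> R.
Hypothesis Ld_smooth : smooth_discrete_lagrangian Ld.
Hypothesis Ld_inv : left_invariant Ld.

Lemma D1_right_translation (h y : G) (v : tangent y) :
  D1 Ld (y * h)%g y (tangent_map (fun z => (z * h)%g) v) =
  - D2 Ld (y * h)%g y v.
Proof.
set x := (y * h)%g.
pose F := coord_Ld Ld x y.
pose a := cmap (chart_at x) x; pose b := cmap (chart_at y) y.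
pose phi := cmap (chart_at x) \o (fun z => (z * h)%g) \o cinv (chart_at y).
have phib : phi b = a by rewrite /phi /= chart_atK.
have dF : differentiable F (a, b) := coord_Ld_differentiable Ld_smooth x y.
have dphi : differentiable phi b := right_translation_differentiable h y.
have dpair : is_diff b (fun w => (phi w, w)) (fun w => ('d phi b w, w)).
  by apply: (is_diff_pair (g := id)); exact: differentiableP.
have dFp : is_diff (phi b, b) F ('d F (a, b)).
  by rewrite phib; exact: differentiableP.
have [dFphi FphiE] := is_diff_comp (f := fun w => (phi w, w)) dpair dFp.
(* With [y' = cinv (chart_at y) w], invariance under [y'] gives [Ld (y' * h) y' = Ld h 1]. This
   holds only near [b], where [y' * h] stays in the domain of the chart at [x]. *)
have Fcst : \forall w \near b, (F \o (fun w => (phi w, w))) w = Ld h 1%g.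
  have cmul : (fun w => (cinv (chart_at y) w * h)%g) @ b --> x.
    have [cm _] := @smooth_mulg R n G.
    have cp : (fun w => (cinv (chart_at y) w, h)) @ b --> (y, h).
      exact: (cvg_pair (@cinv_chart_at_cvg _ _ _ y) (cvg_cst h)).
    exact: cvg_comp cp (cm (y, h)).
  have [odx _ xK _ _] := atlas_chart _ (chart_at_atlas x).
  have ndx : \forall w \near b, dom (chart_at x) (cinv (chart_at y) w * h)%g.
    exact: (cmul _ (open_nbhs_nbhs (conj odx (chart_at_dom x)))).
  near=> w.
  have dw : dom (chart_at x) (cinv (chart_at y) w * h)%g by near: w.
  rewrite /F /phi /coord_Ld /= xK//.
  by rewrite -[in X in Ld _ X](mulg1 (cinv _ w)) Ld_inv.
have /eqP := diff_locally_cst v dFphi Fcst; rewrite FphiE /=.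
(* Splitting the vector separates the contributions of the two arguments of [Ld]. *)
rewrite -[X in 'd F _ X](_ : ('d phi b v, 0) + (0, v) = _); last first.
  by congr pair; rewrite ?addr0 ?add0r.
rewrite linearD addr_eq0 => /eqP dFE.
apply: etrans (D1E Ld_smooth y _) _; apply: etrans dFE _.
by congr (- _); apply/esym; exact: D2E.
Unshelve. all: by end_near. Qed.

Variable kappa : forall x : G, tangent x -> tangent x -> R.
Hypothesis km : riemannian_metric kappa.
Hypothesis kappa_inv : bi_invariant kappa.

Lemma hamiltonian_D1_D2 (x y : G) :
  hamiltonian (kinetic_lagrangian kappa) (- D1 Ld x y) =
  hamiltonian (kinetic_lagrangian kappa) (- D2 Ld x y).
Proof.
have -> : x = (y * (y^-1 * x))%g by rewrite mulgA mulgV mul1g.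
set h := (y^-1 * x)%g.
pose phi := cmap (chart_at (y * h)%g) \o (fun z => (z * h)%g) \o
  cinv (chart_at y).
(* The sign of [T] absorbs the one in [D1_right_translation] and does not affect [kappa]. *)
pose T : 'Hom(tangent y, tangent (y * h)%g) :=
  - linfun ('d phi (cmap (chart_at y) y)).
have TE v : T v = - tangent_map (fun z => (z * h)%g) v.
  by rewrite opp_lfunE lfunE.
apply: (hamiltonian_isometry km (T := T)) => [u v|v].
  by rewrite !TE metricNN// (kappa_inv h u v).2.
rewrite [LHS]opp_lfunE [RHS]opp_lfunE; congr (- _).
apply: etrans (congr1 (D1 Ld (y * h)%g y) (TE v)) _.
apply: etrans (linearN _ _) _; apply: (canLR opprK).
exact: D1_right_translation.
Qed.

End RightTranslation.

(** * Energy preservation of the method *)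

Theorem theorem1 (R : realType) (n : nat) (G : lieGroupType R n)
    (kappa : forall x : G, tangent x -> tangent x -> R)
    (kappa_metric : riemannian_metric kappa)
    (kappa_inv : bi_invariant kappa)
    (r : nat) (D : forall x : G, {vspace tangent x})
    (D_smooth : smooth_distribution r D)
    (P Q : forall x : G, 'End(tangent x))
    (P_proj : forall x, orthogonal_projector kappa [set` D x] (P x))
    (Q_proj : forall x, orthogonal_projector kappa
                (orthogonal_complement kappa [set` D x]) (Q x))
    (Ld : G -> G -> R)
    (Ld_smooth : smooth_discrete_lagrangian Ld)
    (Ld_inv : left_invariant Ld)
    (N : nat) (N_ge2 : (2 <= N)%N) (g : nat -> G)
    (method_P : forall k : nat, (1 <= k <= N - 1)%N ->
       dual_map (P (g k)) (D1 Ld (g k) (g k.+1)) +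
       dual_map (P (g k)) (D2 Ld (g k.-1) (g k)) = 0)
    (method_Q : forall k : nat, (1 <= k <= N - 1)%N ->
       dual_map (Q (g k)) (D1 Ld (g k) (g k.+1)) -
       dual_map (Q (g k)) (D2 Ld (g k.-1) (g k)) = 0) :
  forall k : nat, (1 <= k <= N - 1)%N ->
    hamiltonian (kinetic_lagrangian kappa) (- D1 Ld (g k) (g k.+1)) =
    hamiltonian (kinetic_lagrangian kappa) (- D1 Ld (g k.-1) (g k)).
Proof.
move=> k kN.
(* The momentum at [g k.-1] is replaced by one of equal energy at [g k], where the reflection
   acts. *)
rewrite [RHS](hamiltonian_D1_D2 Ld_smooth Ld_inv kappa_metric kappa_inv).
apply: (hamiltonian_isometry kappa_metric (T := Q (g k) - P (g k))).
  exact: reflection_isometry.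
move=> v; rewrite [LHS]opp_lfunE [RHS]opp_lfunE; congr (- _).
apply: (lfun_reflection (method_P _ kN) (method_Q _ kN)).
by move=> w; rewrite (orthogonal_projectorC kappa_metric (P_proj _) (Q_proj _)).
Qed.
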